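(* Let $\pi$ be a unitary representation of a discrete group $\Gamma$ on $\mathcal{H}$ and suppose there exists a set of vectors $\mathcal{G}\subseteq\mathcal{H}$ such that $\{\pi(\gamma)g:\gamma\in\Gamma,\,g\in\mathcal{G}\}$ is complete in $\mathcal{H}$ and, for every $g\in\mathcal{G}$, $\{\pi(\gamma)g:\gamma\in\Gamma\}$ is a Bessel system in $\mathcal{H}$. Then for every $\gamma\in\Gamma$ with $o(\gamma)=\infty$, the scalar spectral measure $\mu$ associated with $\pi(\gamma)$ is absolutely continuous with respect to the arc length measure on the unit circle $S_1$.
   Context: $\mathcal{H}$ is an infinite-dimensional separable complex Hilbert space. The order $o(\gamma)$ of $\gamma\in\Gamma$ is the smallest positive integer $m$ with $\gamma^m=1$, and $o(\gamma)=\infty$ if no such $m$ exists. The system $\{\pi(\gamma)g:\gamma\in\Gamma\}$ is regarded as a family indexed by $\gamma\in\Gamma$ (repetitions counted). A family is complete if its closed linear span is $\mathcal{H}$; a family $\{f_i\}_{i\in I}$ is Bessel if there is $\beta\ge0$ with $\sum_i|\langle f,f_i\rangle|^2\le\beta\|f\|^2$ for all $f\in\mathcal{H}$. Scalar spectral measure of a normal operator $T$: by the spectral theorem with multiplicity, there are mutually singular compactly supported non-negative Borel measures $\mu_j$ on $\mathbb{C}$, $j\in\{1,2,\dots\}\cup\{\infty\}$, such that $T$ is unitarily equivalent to $N^{(\infty)}_{\mu_\infty}\oplus N_{\mu_1}\oplus N^{(2)}_{\mu_2}\oplus\cdots$, where $N_{\mu_j}$ is multiplication by $z$ on $L^2(\mu_j)$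 and $N^{(j)}_{\mu_j}$ is the direct sum of $j$ copies of it. The scalar spectral measure is $\mu=\sum_{1\le j\le\infty}\mu_j$ (well defined up to mutual absolute continuity). For unitary $T$ it is concentrated on $S_1$. *)

(* Defs.v *)
From HB Require Import structures.
From mathcomp Require Import all_boot all_order all_algebra.
From mathcomp Require Import all_classical all_reals all_analysis.
From mathcomp Require Import measurable_realfun.
From mathcomp.real_closed Require Import complex.

Set Implicit Arguments.
Unset Strict Implicit.
Unset Printing Implicit Defensive.

Import Order.TTheory GRing.Theory Num.Theory.
Import numFieldNormedType.Exports.

Local Open Scope classical_set_scope.
Local Open Scope ring_scope.
Local Open Scope complex_scope.

(* Norms over R[i] are R[i]-valued (with zero imaginary part). *)
Definition rnorm (R : realType) (V : normedZmodType R[i]) (x : V) : R :=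
  complex.Re `|x|.

Section HilbertSpaces.
Variables (R : realType) (H : completeNormedModType R[i]).

Definition lin_span (A : set H) : set H :=
  [set v | exists n (c : 'I_n -> R[i]) (u : 'I_n -> H),
     (forall i, A (u i)) /\ v = \sum_(i < n) c i *: u i].

Definition infinite_dimensional : Prop :=
  forall s : seq H, lin_span [set` s] <> [set: H].

Definition separable : Prop := exists2 D : set H, countable D & dense D.

Definition complete_system (A : set H) : Prop :=
  closure (lin_span A) = [set: H].

Variable dot : {dot H for Num.conj}.

(* The norm of [H] is the one induced by [dot], so that [H] with [dot] is a
   Hilbert space; [dot] is linear on the left, conjugate-linear on the right. *)
Definition hilbert_norm : Prop := forall x : H, `|x| ^+ 2 = dot x x.

Definition bessel (I : choiceType) (f : I -> H) : Prop :=
  exists2 beta : R, 0 <= beta &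
    forall x : H, (\esum_(i in [set: I]) (rnorm (dot x (f i)) ^+ 2)%:E
                   <= (beta * rnorm x ^+ 2)%:E)%E.

Definition unitary_op (T : H -> H) : Prop :=
  [/\ linear T, forall x y, dot (T x) (T y) = dot x y & range T = [set: H]].

Definition unitary_representation (G : groupType) (pi : G -> H -> H) : Prop :=
  [/\ forall a, unitary_op (pi a), pi 1%g = id &
      forall a b, pi (a * b)%g = pi a \o pi b].

End HilbertSpaces.

Definition infinite_order (G : groupType) (a : G) : Prop :=
  forall m : nat, (0 < m)%N -> (a ^+ m)%g <> 1%g.

Definition borelC (R : realType) : measurableType _ :=
  g_sigma_algebraType (@open (R[i] : numFieldType)).

Section ArcLength.
Variable R : realType.

Definition circle_map (t : R) : borelC R := cos t +i* sin t.

Lemma circle_map_continuous :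
  continuous (circle_map : R -> (R[i] : numFieldType)).
Proof.
move=> t; apply/cvgrPdist_lt => /= e e0.
have eE : e = (complex.Re e)%:C.
  by apply/eqP; rewrite eq_complex /= eqxx /=; case: e e0 => a b; rewrite ltcE /= => /andP[].
have e2 : 0 < complex.Re e / 2.
  by move: e0; rewrite ltcE => /andP[_ ?]; rewrite divr_gt0.
have hc := @continuous_cos R t; have hs := @continuous_sin R t.
move/cvgrPdist_lt : hc => /(_ _ e2) hc; move/cvgrPdist_lt : hs => /(_ _ e2) hs.
near=> s.
have c1 : `|cos t - cos s| < complex.Re e / 2 by near: s.
have s1 : `|sin t - sin s| < complex.Re e / 2 by near: s.
have -> : circle_map t - circle_map s =
    (cos t - cos s)%:C + 'i * (sin t - sin s)%:C :> R[i].
  by rewrite /circle_map; apply/eqP; rewrite eq_complex /= !(mul0r, mul1r, mulr0, subr0, addr0, add0r) !eqxx.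
rewrite eE; apply: le_lt_trans (ler_normD _ _) _.
rewrite normrM !normc_def /= !expr0n /= expr1n !(addr0, add0r) sqrtr1 mul1r.
by rewrite !sqrtr_sqr -rmorphD /= ltcR [ltRHS]splitr ltrD.
Unshelve. all: by end_near. Qed.

Lemma measurable_circle_map : measurable_fun [set: R] circle_map.
Proof.
apply: (@measurability _ _ R (borelC R) setT circle_map
  (@open (R[i] : numFieldType))) => //.
move=> _ [V oV <-]; rewrite setTI; apply: open_measurable.
by move/continuousP : circle_map_continuous; exact.
Qed.

Definition arc_length : set (borelC R) -> \bar R :=
  pushforward (mrestr (@lebesgue_measure R) (measurable_itv `[0, 2 * pi[))
    circle_map.

HB.instance Definition _ := Measure.copy arc_length
  (measure_function_pushforward__canonical__measure_function_Measure
     (mrestr (@lebesgue_measure R) (measurable_itv `[0, 2 * pi[))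
     measurable_circle_map).

End ArcLength.

Section ScalarSpectralMeasure.
Variable R : realType.

(* [Some n] stands for the finite multiplicity n + 1, [None] for infinity;
   [copies j] indexes the direct summands L^2(nu j) of multiplicity j. *)
Definition multiplicity := option nat.

Definition copies (j : multiplicity) : set nat :=
  if j is Some n then `I_n.+1 else [set: nat].

(* Representatives of the vectors of the direct sum over j of
   L^2(nu j)^(copies j); the components outside [copies j] are irrelevant. *)
Definition families := multiplicity -> nat -> borelC R -> borelC R.

Variable nu : multiplicity -> {finite_measure set (borelC R) -> \bar R}.

Definition l2sum_normsq (F : families) : \bar R :=
  (\esum_(jk in [set jk : multiplicity * nat | copies jk.1 jk.2])
    \int[nu jk.1]_z (rnorm (F jk.1 jk.2 z : R[i]) ^+ 2)%:E)%E.

Definition l2sum : set families :=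
  [set F | (forall j k, copies j k -> measurable_fun [set: borelC R] (F j k)) /\
           (l2sum_normsq F < +oo)%E].

Definition l2sum_eq (F G : families) : Prop :=
  forall j k, copies j k -> F j k = G j k %[ae nu j].

Definition mul_z (F : families) : families :=
  fun j k z => (z : R[i]) * (F j k z : R[i]).

(* [T] is unitarily equivalent to the direct sum of the multiplication
   operators: [U x] is a representative of the image of [x] under a surjective
   linear isometry onto the direct sum. *)
Definition unitarily_equivalent_to_mul_z (H : completeNormedModType R[i])
    (T : H -> H) : Prop :=
  exists U : H -> families,
    [/\ forall x, l2sum (U x),
        forall (a : R[i]) x y, l2sum_eq (U (a *: x + y))
          (fun j k z => a * (U x j k z : R[i]) + (U y j k z : R[i])),
        forall x, l2sum_normsq (U x) = (rnorm x ^+ 2)%:E,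
        forall F, l2sum F -> exists x, l2sum_eq (U x) F &
        forall x, l2sum_eq (U (T x)) (mul_z (U x))].

Definition compactly_supported (m : set (borelC R) -> \bar R) : Prop :=
  exists2 K : set (R[i] : numFieldType), compact K & m (~` K) = 0%E.

Definition mutually_singular (m1 m2 : set (borelC R) -> \bar R) : Prop :=
  exists A : set (borelC R), [/\ measurable A, m1 A = 0%E & m2 (~` A) = 0%E].

End ScalarSpectralMeasure.

(* The multiplicity measures [nu j] being unique only up to equivalence, this
   is a relation: it holds of every sum of [nu j] realizing [T]. *)
Definition scalar_spectral_measure (R : realType)
    (H : completeNormedModType R[i]) (T : H -> H)
    (mu : {measure set (borelC R) -> \bar R}) : Prop :=
  exists nu : multiplicity -> {finite_measure set (borelC R) -> \bar R},
    [/\ forall j, compactly_supported (nu j),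
        forall i j, i <> j -> mutually_singular (nu i) (nu j),
        unitarily_equivalent_to_mul_z nu T &
        forall A, measurable A -> mu A = (\esum_(j in [set: multiplicity]) nu j A)%E].

(* Main.v *)
Require Import Defs.
From HB Require Import structures.
From mathcomp Require Import all_boot all_order all_algebra.
From mathcomp Require Import all_classical all_reals all_analysis.
From mathcomp Require Import measurable_realfun.
From mathcomp.real_closed Require Import complex.
From mathcomp Require Import ring lra.

Set Implicit Arguments.
Unset Strict Implicit.
Unset Printing Implicit Defensive.

Import Order.TTheory GRing.Theory Num.Theory.
Import numFieldNormedType.Exports.

Local Open Scope classical_set_scope.
Local Open Scope ring_scope.

(** Write [T] for [pi gamma]. As [gamma] has infinite order, for every [g] in
    [G] and every [a] the vectors [T^n x], with [x = pi a g], form a subfamily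
    without repetitions of a Bessel system, so that their synthesis operator is
    bounded ([bessel_synthesis]): for unimodular [c_n],
    [|| sum_(n < N) c_n T^n x ||^2 <= beta N]. In the spectral representation
    this reads [int |p|^2 d mu_x <= beta N], where [p(z) = sum_(n < N) c_n z^n]
    and [mu_x] is the spectral measure of [x] (in the proof, the contribution of
    one summand to it). With [c_n = w^-n] and [w] on the
    unit circle, [|p| >= N/2] on the disc of centre [w] and radius [1/(2N)]
    ([rnorm_geom_ge]); hence [mu_x] gives to an arc a mass at most proportional
    to its length ([component_mass_disc]). A set of arc length zero is covered
    by arcs of arbitrarily small total length ([arc_null_cover]), so that [mu_x]
    vanishes on it ([component_mass_null]). Only nonnegative integrals of
    squared moduli are needed: neither Fourier analysis nor a density argument
    for trigonometric polynomials is involved.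

    For a fixed Borel set [B], the vectors [x] with [mu_x(B) = 0] form a closed
    linear subspace. When [B] is a null set of the circle, this subspace
    contains the complete system of the hypothesis, so it is the whole space;
    the vector represented by the indicator function of [B] in one summand
    [L^2(nu j)] then shows that [nu j] vanishes on [B] ([indicator_vector]).
    Finally, [arc_length] ignores the complement of the circle, and so do the
    measures [nu j] because [T] is an isometry ([off_circle_null]). *)

(** * The real-valued norm *)

Section RealNorm.
Variables (R : realType) (V : normedZmodType R[i]).
Implicit Types x y : V.

Lemma normE_rnorm x : `|x| = ((rnorm x)%:C)%C.
Proof. by rewrite /rnorm RRe_real// normr_real. Qed.

Lemma rnorm_ge0 x : 0 <= rnorm x.
Proof. by rewrite -ler0c -normE_rnorm normr_ge0. Qed.

Lemma ler_rnormD x y : rnorm (x + y) <= rnorm x + rnorm y.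
Proof. by rewrite -lecR rmorphD/= -!normE_rnorm ler_normD. Qed.

Lemma rnormN x : rnorm (- x) = rnorm x.
Proof. by rewrite /rnorm normrN. Qed.

Lemma rnorm0 : rnorm (0 : V) = 0.
Proof. by rewrite /rnorm normr0. Qed.

Lemma ler_rnormB_dist x y : `|rnorm x - rnorm y| <= rnorm (x - y).
Proof.
rewrite ler_norml lerBlDr [rnorm (x - y) + _]addrC.
have h1 := ler_rnormD y (x - y); rewrite subrKC in h1; rewrite h1 andbT.
have := ler_rnormD x (y - x); rewrite subrKC => h2.
have : rnorm (x - y) = rnorm (y - x) by rewrite -opprB rnormN.
lra.
Qed.

Lemma rnormD_sqr x y :
  rnorm (x + y) ^+ 2 <= 2 * rnorm x ^+ 2 + 2 * rnorm y ^+ 2.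
Proof.
have := ler_rnormD x y; have := rnorm_ge0 (x + y).
have := rnorm_ge0 x; have := rnorm_ge0 y.
move: (rnorm (x + y)) (rnorm x) (rnorm y) => a b c c0 b0 a0 abc.
have abc2 : a ^+ 2 <= (b + c) ^+ 2 by rewrite lerXn2r// nnegrE addr_ge0.
have := sqr_ge0 (b - c); move: abc2; rewrite sqrrB sqrrD.
lra.
Qed.

Lemma rnorm_sum (I : Type) (s : seq I) (F : I -> V) :
  rnorm (\sum_(i <- s) F i) <= \sum_(i <- s) rnorm (F i).
Proof.
elim/big_ind2: _ => [|a b c d ab cd|//]; first by rewrite rnorm0.
by apply: le_trans (ler_rnormD _ _) _; rewrite lerD.
Qed.

End RealNorm.

Section RealNormScalars.
Variable R : realType.
Implicit Types z w : R[i].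

Lemma rnormM z w : rnorm (z * w) = rnorm z * rnorm w.
Proof. by apply: complexI; rewrite rmorphM/= -!normE_rnorm normrM. Qed.

Lemma rnorm1 : rnorm (1 : R[i]) = 1.
Proof. by rewrite /rnorm normr1. Qed.

Lemma rnormX z n : rnorm (z ^+ n) = rnorm z ^+ n.
Proof. by elim: n => [|n ih]; rewrite ?expr0 ?rnorm1// !exprS rnormM ih. Qed.

Lemma rnormJ z : rnorm (Num.conj z) = rnorm z.
Proof. by rewrite /rnorm norm_conjC. Qed.

Lemma rnormcE z :
  rnorm z = Num.sqrt (complex.Re z ^+ 2 + complex.Im z ^+ 2).
Proof. by rewrite /rnorm normc_def. Qed.

Lemma rnorm_le_ReIm z : rnorm z <= `|complex.Re z| + `|complex.Im z|.
Proof.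
rewrite rnormcE.
rewrite -(ger0_norm (addr_ge0 (normr_ge0 (complex.Re z)) (normr_ge0 (complex.Im z)))).
rewrite -sqrtr_sqr ler_wsqrtr// -(real_normK (num_real (complex.Re z))).
rewrite -(real_normK (num_real (complex.Im z))) sqrrD.
by rewrite lerD2r lerDl mulrn_wge0// mulr_ge0.
Qed.

Lemma Re_le_rnorm z : complex.Re z <= rnorm z.
Proof.
apply: le_trans (ler_norm _) _; rewrite -lecR -normE_rnorm; exact: normc_ge_Re.
Qed.

End RealNormScalars.

(** * Borel functions of a complex variable *)

Section BorelC.
Variable R : realType.

(** A real function on the complex plane that is 1-Lipschitz is Borel. *)
Lemma lipschitz_measurable (f : R[i] -> R) :
  (forall z w, `|f z - f w| <= rnorm (z - w)) ->
  measurable_fun [set: borelC R] (f : borelC R -> R).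
Proof.
move=> lipf; apply: (measurability (@RGenOpens.G R)).
  exact: RGenOpens.measurableE.
move=> _ [_ [a [b ->]] <-]; rewrite setTI.
apply: sub_sigma_algebra.
rewrite /= openE => z /= abfz.
have /nbhs_ballP[e /= e0 sub] : nbhs (f z) `]a, b[%classic.
  by apply: open_nbhs_nbhs; split => //; exact: interval_open.
exists (e%:C)%C; first by rewrite /= ltcR.
move=> w; rewrite /ball_/= normE_rnorm ltcR => zw.
by apply: sub; rewrite -ball_normE /=; exact: le_lt_trans zw.
Qed.

Lemma measurable_rnormB (w : R[i]) :
  measurable_fun [set: borelC R] (fun z : borelC R => rnorm ((z : R[i]) - w)).
Proof.
apply: lipschitz_measurable => z z'; apply: le_trans (ler_rnormB_dist _ _) _.
by rewrite opprB addrA subrK.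
Qed.

Lemma measurable_rnorm :
  measurable_fun [set: borelC R] (fun z : borelC R => rnorm (z : R[i])).
Proof.
by apply: lipschitz_measurable => z z'; exact: ler_rnormB_dist.
Qed.

Lemma measurable_unit_circle :
  measurable [set z : borelC R | rnorm (z : R[i]) = 1].
Proof.
by have := measurable_rnorm measurableT (measurable_set1 1); rewrite setTI.
Qed.

Lemma measurable_sqnorm (F : borelC R -> borelC R) (D : set (borelC R)) :
  measurable_fun [set: borelC R] F ->
  measurable_fun D (fun z => (rnorm (F z : R[i]) ^+ 2)%:E).
Proof.
move=> mF; apply: (@measurable_funS _ _ _ _ setT) => //.
apply/measurable_EFinP/measurable_funX.
by apply: (measurableT_comp measurable_rnorm).
Qed.

End BorelC.

(** * Bessel systems and geometric polynomials *)

Section BesselPolynomials.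
Variables (R : realType) (H : completeNormedModType R[i]).
Variable dot : {dot H for Num.conj}.
Hypothesis hilbertH : hilbert_norm dot.

Lemma dot_rnorm (y : H) : dot y y = ((rnorm y ^+ 2)%:C)%C.
Proof. by rewrite -hilbertH normE_rnorm rmorphXn. Qed.

(** The synthesis operator of a Bessel family is bounded, here for finitely
    supported unimodular coefficients along a repetition-free subfamily. *)
Lemma bessel_synthesis (I : choiceType) (f : I -> H) : bessel dot f ->
  exists2 beta : R, 0 < beta &
    forall (e : nat -> I) (c : nat -> R[i]) N, injective e ->
      (forall n, rnorm (c n) = 1) ->
      rnorm (\sum_(n < N) c n *: f (e n)) ^+ 2 <= beta * N%:R.
Proof.
move=> [b b0 besself]; exists (b + 1); first by rewrite ltr_wpDl.
move=> e c N inje c1; set y := \sum_(n < N) _.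
pose a n := rnorm (dot y (f (e n))).
have sum_sq : \sum_(n < N) a n ^+ 2 <= (b + 1) * rnorm y ^+ 2.
  apply: (@le_trans _ _ (b * rnorm y ^+ 2)).
    rewrite -lee_fin -sumEFin; apply: le_trans (besself y).
    apply: esum_ge; exists (e @` `I_N).
      by split => //; exact/finite_image/finite_II.
    rewrite fsbig_image; last by move=> m n _ _; exact: inje.
    by rewrite -fsbig_ord.
  by rewrite ler_wpM2r ?sqr_ge0// lerDl.
have y2 : rnorm y ^+ 2 <= \sum_(n < N) a n.
  have -> : rnorm y ^+ 2 = complex.Re (dot y y) by rewrite dot_rnorm.
  rewrite {2}/y linear_sumr; apply: le_trans (Re_le_rnorm _) _.
  apply: le_trans (rnorm_sum _ _) _; apply: ler_sum => n _.
  by rewrite linearZr_LR/= rnormM rnormJ c1 mul1r.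
(* The weighted arithmetic-geometric mean replaces Cauchy-Schwarz: its second
   term, summed over [n], is already the bound. *)
have amgm : \sum_(n < N) 2 * a n <=
    \sum_(n < N) ((b + 1)^-1 * a n ^+ 2 + (b + 1)).
  apply: ler_sum => n _; have bp : 0 < b + 1 by rewrite ltr_wpDl.
  rewrite -subr_ge0.
  have -> : (b + 1)^-1 * a n ^+ 2 + (b + 1) - 2 * a n =
      (b + 1)^-1 * (a n - (b + 1)) ^+ 2 by field; rewrite gt_eqF.
  by rewrite mulr_ge0 ?sqr_ge0// invr_ge0 ltW.
move: amgm; rewrite -mulr_sumr big_split/= -mulr_sumr sumr_const card_ord.
have : (b + 1)^-1 * \sum_(n < N) a n ^+ 2 <= rnorm y ^+ 2.
  by rewrite ler_pdivrMl// ltr_wpDl.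
rewrite -[(b + 1) *+ N]mulr_natr; lra.
Qed.

End BesselPolynomials.

(** On the unit circle, the polynomial with coefficients [w^-n] has modulus [N]
    at [w], and keeps half of it at a distance of order [1/N]. *)
Lemma rnorm_geom_ge (R : realType) (w z : R[i]) (N : nat) :
  rnorm w = 1 -> rnorm z = 1 -> N%:R * rnorm (z - w) <= 1 / 2 ->
  N%:R / 2 <= rnorm (\sum_(n < N) (w^-1) ^+ n * z ^+ n).
Proof.
move=> w1 z1 zw.
have w0 : w != 0 by apply/eqP => w0; move: w1; rewrite w0 rnorm0; lra.
pose u := w^-1 * z.
have u1 : rnorm u = 1.
  have := rnormM w w^-1; rewrite divff// rnorm1 w1 mul1r => V1.
  by rewrite rnormM -V1 z1 mulr1.
have du : rnorm (u - 1) = rnorm (z - w).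
  have -> : z - w = w * (u - 1) by rewrite mulrBr mulr1 mulrA divff// mul1r.
  by rewrite rnormM w1 mul1r.
have dun n : rnorm (u ^+ n - 1) <= n%:R * rnorm (z - w).
  elim: n => [|n ih]; first by rewrite expr0 subrr rnorm0 mul0r.
  have -> : u ^+ n.+1 - 1 = u * (u ^+ n - 1) + (u - 1) by rewrite exprS; ring.
  apply: le_trans (ler_rnormD _ _) _; rewrite rnormM u1 mul1r du.
  by rewrite -natr1 mulrDl mul1r lerD2r.
have -> : \sum_(n < N) (w^-1) ^+ n * z ^+ n =
    N%:R + \sum_(n < N) (u ^+ n - 1).
  rewrite big_split/= sumrN sumr_const card_ord addrCA subrr addr0.
  by apply: eq_bigr => n _; rewrite -exprMn.
set S := \sum_(n < N) _.
have S_le : rnorm S <= N%:R / 2.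
  apply: le_trans (rnorm_sum _ _) _.
  apply: (@le_trans _ _ (\sum_(n < N) (1 / 2))).
    apply: ler_sum => n _; apply: le_trans (dun n) _; apply: le_trans zw.
    by rewrite ler_wpM2r ?rnorm_ge0// ler_nat ltnW.
  by rewrite sumr_const card_ord -mulr_natl; lra.
have NS : rnorm (N%:R : R[i]) = N%:R.
  by apply: complexI; rewrite -normE_rnorm normr_nat rmorph_nat.
have := ler_rnormD (N%:R + S) (- S); rewrite addrK rnormN NS; lra.
Qed.

(** * The unit circle and arc length *)

Section CircleGeometry.
Variable R : realType.
Implicit Types s t : R.

Lemma rnorm_circle_map t : rnorm (circle_map t : R[i]) = 1.
Proof. by rewrite rnormcE /= cos2Dsin2 sqrtr1. Qed.

Lemma derive_bounded_lipschitz (f df : R -> R) :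
  (forall x : R, is_derive x (1 : R) f (df x)) -> (forall x, `|df x| <= 1) ->
  forall s t, `|f s - f t| <= `|s - t|.
Proof.
move=> fdf df1 s t; wlog ts : s t / t <= s => [H|].
  have [|/ltW] := leP t s; first exact: H.
  by rewrite distrC (distrC s); exact: H.
have cf : {within `[t, s], continuous f}.
  by apply: derivable_within_continuous => x _; have [] := fdf x.
have [c _ ->] := MVT_segment ts (fun x _ => fdf x) cf.
by rewrite normrM ler_piMl.
Qed.

Lemma circle_map_lipschitz s t :
  rnorm ((circle_map s : R[i]) - circle_map t) <= 2 * `|s - t|.
Proof.
apply: le_trans (rnorm_le_ReIm _) _; rewrite /= mulr_natl mulr2n lerD//.
- apply: (derive_bounded_lipschitz (@is_derive_cos R)) => x.
  by rewrite normrN sin_max.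
- exact: (derive_bounded_lipschitz (@is_derive_sin R) (@cos_max R)).
Qed.

Lemma circle_map_surj (z : R[i]) : rnorm z = 1 ->
  exists2 t, t \in `[0, 2 * pi[ & circle_map t = z.
Proof.
case: z => a b; rewrite rnormcE /= => ab1.
have {}ab1 : a ^+ 2 + b ^+ 2 = 1.
  by rewrite -[LHS]sqr_sqrtr ?addr_ge0 ?sqr_ge0// ab1 expr1n.
have a1 : -1 <= a <= 1.
  by have b2 := sqr_ge0 b; apply/andP; split; nra.
have acosa : cos (acos a) = a by apply: acosK; rewrite in_itv.
have sina : sin (acos a) = `|b|.
  by rewrite sin_acos// -ab1 addrAC subrr add0r sqrtr_sqr.
have pi0 := pi_gt0 R; have ac0 := acos_ge0 a1; have acpi := acos_lepi a1.
have [b0|b0] := leP 0 b.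
  (* The principal angle serves in the closed upper half-plane, its reflection
     below, where [acos a > 0] keeps [2 * pi - acos a] away from [2 * pi]. *)
  exists (acos a); first by rewrite in_itv/=; lra.
  by rewrite /circle_map acosa sina ger0_norm.
have ac_gt0 : 0 < acos a.
  rewrite lt_neqAle ac0 andbT eq_sym; apply/eqP => aca.
  by move: sina; rewrite aca sin0 => /esym/eqP; rewrite normr_eq0 lt_eqF.
exists (2 * pi - acos a); first by rewrite in_itv/=; lra.
have -> : 2 * pi - acos a = - acos a + pi *+ 2 by rewrite mulr_natl addrC.
rewrite /circle_map cosD2pi sinD2pi cosN sinN acosa sina ltr0_norm//.
by rewrite opprK.
Qed.

(** The part on the circle of a set of null arc length is covered by open discs
    centred on the circle whose radii have an arbitrarily small sum. A zero
    radius stands for an empty disc. *)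
Lemma arc_null_cover (A : set (borelC R)) (e : R) : 0 < e ->
  arc_length A = 0%E ->
  exists (w : nat -> R[i]) (r : nat -> R),
    [/\ forall i, rnorm (w i) = 1, forall i, 0 <= r i,
        forall z : R[i], A z -> rnorm z = 1 -> exists i, rnorm (z - w i) < r i &
        (\sum_(i <oo) (r i)%:E <= e%:E)%E].
Proof.
move=> e0 A0.
set E : set R := @circle_map R @^-1` A `&` `[0, 2 * pi[.
(* Lebesgue measure is by definition the outer measure built on lengths of
   intervals, so its infimum over coverings by open intervals is available. *)
have E0 : ((wlength idfun)^* E)%mu = 0%E by exact: A0.
have [F [Fitv EF] Fe] : exists2 F, open_itv_cover E F &
    (\sum_(k <oo) wlength idfun (F k) <= (e / 2)%:E)%E.
  have e20 : 0 < e / 2 by rewrite divr_gt0.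
  have Efin : ((wlength idfun)^* E)%mu \is a fin_num by rewrite E0.
  move: (E0) Efin; rewrite outer_measure_open_itv_cover => E0'.
  move=> /lb_ereal_inf_adherent-/(_ _ e20)[_/= [F]] AF <-.
  by rewrite E0' add0e => /ltW Fe; exists F.
have [ab abE] := choice Fitv.
pose r i := if (ab i).1 < (ab i).2 then 2 * ((ab i).2 - (ab i).1) else 0.
have rE i : (r i)%:E = (2%:E * wlength idfun (F i))%E.
  rewrite abE wlength_itv/= lte_fin /r.
  by case: ifPn => _; rewrite ?mule0// EFinM EFinB.
exists (fun i => circle_map (ab i).1), r; split.
- by move=> i; exact: rnorm_circle_map.
- by move=> i; rewrite /r; case: ifPn => // abi; rewrite mulr_ge0// subr_ge0 ltW.
- move=> z Az /circle_map_surj[t t02 tz].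
  have [|i _ Fit] := EF t; first by split => //; rewrite /= tz.
  move: Fit; rewrite abE /= in_itv/= => /andP[abt tab].
  exists i; rewrite -tz; apply: le_lt_trans (circle_map_lipschitz _ _) _.
  by rewrite /r (lt_trans abt tab) ltr_pM2l// ger0_norm ?ltrD2r// subr_ge0 ltW.
- under eq_eseriesr do rewrite rE.
  rewrite nneseriesZl; last by move=> i _; rewrite wlength_ge0.
  have -> : e%:E = (2%:E * (e / 2)%:E)%E by rewrite -EFinM; congr EFin; field.
  by rewrite lee_pmul2l.
Qed.

End CircleGeometry.

(** * Spectral measures of vectors *)

Section Covers.
Variables (d : measure_display) (T : measurableType d) (R : realType).
Variable m : {measure set T -> \bar R}.

Lemma nneseries_ge_term (u : nat -> \bar R) i :
  (forall n, (0 <= u n)%E) -> (u i <= \sum_(n <oo) u n)%E.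
Proof.
move=> u0; apply: le_trans (nneseries_lim_ge i.+1 _) => //.
by rewrite big_nat_recr//= leeDr// sume_ge0.
Qed.

(** Countable subadditivity of the measure with density [g]. *)
Lemma integral_cover_le (g : T -> \bar R) (A : set T) (B : nat -> set T) :
  measurable_fun [set: T] g -> (forall z, (0 <= g z)%E) ->
  measurable A -> (forall i, measurable (B i)) -> A `<=` \bigcup_i B i ->
  (\int[m]_(z in A) g z <= \sum_(i <oo) \int[m]_(z in B i) g z)%E.
Proof.
move=> mg g0 mA mB AB.
have restr0 D z : (0 <= (g \_ D) z)%E by rewrite patchE; case: ifPn.
have mrestr D : measurable D -> measurable_fun setT (g \_ D).
  move=> mD; apply/measurable_restrict => //.
  by apply: measurable_funS mg.
rewrite integral_mkcond; under eq_eseriesr do rewrite integral_mkcond.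
rewrite -integral_nneseries//; last by move=> n; exact: mrestr.
apply: ge0_le_integral => //; first exact: mrestr.
- apply: ge0_emeasurable_sum => // n _; exact: mrestr.
- move=> z _; rewrite patchE; case: ifPn => [/set_mem Az|_]; last first.
    by apply: nneseries_ge0.
  have [i _ Biz] := AB z Az.
  have -> : g z = (g \_ (B i)) z by rewrite patchE mem_set.
  exact: (nneseries_ge_term (u := fun n => (g \_ (B n)) z)).
Qed.

End Covers.

Section SpectralComponents.
Variables (R : realType) (H : completeNormedModType R[i]).
Variable nu : multiplicity -> {finite_measure set (borelC R) -> \bar R}.
Variables (T : H -> H) (U : H -> families R).
Hypothesis U_l2 : forall x, l2sum nu (U x).
Hypothesis U_lin : forall (a : R[i]) x y, l2sum_eq nu (U (a *: x + y))
  (fun j k z => a * (U x j k z : R[i]) + (U y j k z : R[i])).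
Hypothesis U_iso : forall x, l2sum_normsq nu (U x) = (rnorm x ^+ 2)%:E.
Hypothesis U_T : forall x, l2sum_eq nu (U (T x)) (mul_z (U x)).
Variables (j : multiplicity) (k : nat).
Hypothesis jk : copies j k.

(** The mass given to [A] by the part of the spectral measure of [x] that comes
    from the [k]-th copy of [L^2(nu j)]. *)
Definition component_mass (A : set (borelC R)) (x : H) : \bar R :=
  (\int[nu j]_(z in A) (rnorm (U x j k z : R[i]) ^+ 2)%:E)%E.

Lemma measurable_component x A :
  measurable_fun A (fun z => (rnorm (U x j k z : R[i]) ^+ 2)%:E).
Proof. by apply: measurable_sqnorm; have [+ _] := U_l2 x; apply. Qed.

Lemma component_mass_ge0 A x : (0 <= component_mass A x)%E.
Proof. by apply: integral_ge0 => z _; rewrite lee_fin sqr_ge0. Qed.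

Lemma component_mass_le A x : measurable A ->
  (component_mass A x <= (rnorm x ^+ 2)%:E)%E.
Proof.
move=> mA; rewrite -U_iso.
apply: (@le_trans _ _ (component_mass setT x)).
  apply: ge0_subset_integral => //; first exact: measurable_component.
  by move=> z _; rewrite lee_fin sqr_ge0.
apply: esum_ge; exists [set (j, k)]; last by rewrite fsbig_set1.
by split => // _ ->.
Qed.

(** Together with [component_mass_le], this makes the vectors whose mass on [A]
    vanishes a closed linear subspace. *)
Lemma component_massD A (a : R[i]) x y : measurable A ->
  (component_mass A (a *: x + y)%R <=
   (2 * rnorm a ^+ 2)%R%:E * component_mass A x + 2%:E * component_mass A y)%E.
Proof.
move=> mA; rewrite /component_mass.
have sq0 v z : (0 <= (rnorm (U v j k z : R[i]) ^+ 2)%:E)%E.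
  by rewrite lee_fin sqr_ge0.
rewrite -!ge0_integralZl_EFin//; try exact: measurable_component.
  2: by rewrite mulr_ge0// sqr_ge0.
rewrite -ge0_integralD//.
- apply: ae_ge0_le_integral => //; first exact: measurable_component.
  + move=> z _; apply: adde_ge0; by rewrite -EFinM lee_fin !mulr_ge0 ?rnorm_ge0.
  + apply: emeasurable_funD; apply: measurable_funeM; exact: measurable_component.
  + apply: filterS (U_lin a x y jk) => z -> // _.
    rewrite -!EFinM -EFinD lee_fin; apply: le_trans (rnormD_sqr _ _) _.
    by rewrite rnormM exprMn mulrA.
- by move=> z _; rewrite -EFinM lee_fin !mulr_ge0 ?rnorm_ge0.
- by apply: measurable_funeM; exact: measurable_component.
- by move=> z _; rewrite -EFinM lee_fin !mulr_ge0 ?rnorm_ge0.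
- by apply: measurable_funeM; exact: measurable_component.
Qed.

Lemma U_iter n x :
  U (iter n T x) j k = (fun z => (z : R[i]) ^+ n * (U x j k z : R[i]))
    %[ae nu j].
Proof.
elim: n => [|n ih].
  by apply: aeW => z _; rewrite expr0 mul1r.
apply: filterS2 ih (U_T (iter n T x) jk) => z /= ih ->// _.
by rewrite /mul_z ih// exprS mulrA.
Qed.

Lemma U_poly (c : nat -> R[i]) N x :
  U (\sum_(n < N) c n *: iter n T x) j k =
    (fun z => (\sum_(n < N) c n * (z : R[i]) ^+ n) * (U x j k z : R[i]))
    %[ae nu j].
Proof.
elim: N => [|N ih].
  (* [U 0] vanishes almost everywhere since [0 = -1 *: 0 + 0]. *)
  have := U_lin (-1) 0 0 jk; rewrite scaler0 addr0 => U0.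
  apply: filterS U0 => z /= e _.
  by rewrite !big_ord0 mul0r e// mulN1r addNr.
have e : \sum_(n < N.+1) c n *: iter n T x =
    c N *: iter N T x + \sum_(n < N) c n *: iter n T x.
  by rewrite big_ord_recr/= addrC.
apply: filterS3 ih (U_iter N x) (U_lin (c N) (iter N T x)
  (\sum_(n < N) c n *: iter n T x) jk) => z /= ih itz lz _.
rewrite e lz// ih// itz// big_ord_recr/= mulrDl addrC.
by rewrite mulrA.
Qed.

(** The part of the unit circle in the open disc of centre [w] and radius [r]. *)
Definition circle_disc (w : R[i]) (r : R) : set (borelC R) :=
  [set z | rnorm (z : R[i]) = 1 /\ rnorm ((z : R[i]) - w) < r].

Lemma measurable_circle_disc w r : measurable (circle_disc w r).
Proof.
have m2 := @measurable_rnormB R w measurableT `]-oo, r[%classic (measurable_itv _).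
move: (measurableI _ _ (@measurable_unit_circle R) m2).
by rewrite setTI; congr measurable; apply/seteqP; split => z /=; rewrite in_itv.
Qed.

(** The spectral measure of a vector whose orbit under [T] has a bounded
    synthesis operator gives an arc a mass of the order of its length. *)
Lemma component_mass_disc (beta : R) x w r : 0 < beta ->
  (forall (c : nat -> R[i]) N, (forall n, rnorm (c n) = 1) ->
     rnorm (\sum_(n < N) c n *: iter n T x) ^+ 2 <= beta * N%:R) ->
  rnorm w = 1 -> 0 <= r <= 1 / 2 ->
  (component_mass (circle_disc w r) x <= (16 * beta * r)%:E)%E.
Proof.
move=> beta0 synth w1 /andP[r0 r12].
move: r0; rewrite le_eqVlt => /predU1P[<-|r0].
  rewrite (_ : circle_disc w 0 = set0).
    by rewrite /component_mass integral_set0 mulr0.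
  by apply/seteqP; split => z //= [_]; rewrite ltNge rnorm_ge0.
have mD := measurable_circle_disc w r.
(* [N] is the largest number of terms for which [rnorm_geom_ge] covers the disc;
   as [r <= 1/2] it is positive, and then [1/N <= 4 r]. *)
pose N := Num.truncn (1 / (2 * r)).
have r20 : 0 < 2 * r by rewrite mulr_gt0.
have Ner : N%:R * (2 * r) <= 1.
  by rewrite -ler_pdivlMr// truncn_le// divr_ge0// ltW.
have N0 : (0 < N)%N by rewrite truncn_gt0 ler_pdivlMr//; lra.
have Nr4 : 1 <= N%:R * (4 * r).
  have : 1 < N.+1%:R * (2 * r) by rewrite -ltr_pdivrMr// truncnS_gt.
  have : (1 : R) <= N%:R by rewrite ler1n.
  rewrite -natr1; nra.
pose c n : R[i] := w^-1 ^+ n.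
have c1 n : rnorm (c n) = 1.
  have w0 : w != 0 by apply/eqP => w0; move: w1; rewrite w0 rnorm0; lra.
  have := rnormM w w^-1; rewrite divff// rnorm1 w1 mul1r => V1.
  by rewrite rnormX -V1 expr1n.
have NR0 : 0 < (N%:R : R) by rewrite ltr0n.
have : (((N%:R / 2) ^+ 2)%R%:E * component_mass (circle_disc w r) x <=
    (beta * N%:R)%R%:E)%E.
  apply: (@le_trans _ _ (component_mass (circle_disc w r)
      (\sum_(n < N) c n *: iter n T x))); last first.
    by apply: le_trans (component_mass_le _ mD) _; rewrite lee_fin synth.
  rewrite /component_mass -ge0_integralZl_EFin ?sqr_ge0//; last 2 first.
    by move=> z _; rewrite lee_fin sqr_ge0.
    exact: measurable_component.
  apply: ae_ge0_le_integral => //.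
  - by move=> z _; rewrite -EFinM lee_fin mulr_ge0// sqr_ge0.
  - by apply: measurable_funeM; exact: measurable_component.
  - by move=> z _; rewrite lee_fin sqr_ge0.
  - exact: measurable_component.
  - apply: filterS (U_poly c N x) => z /= e [z1 zw].
    rewrite e// -EFinM lee_fin rnormM [X in _ <= X]exprMn ler_wpM2r ?sqr_ge0//.
    rewrite lerXn2r ?nnegrE ?rnorm_ge0 ?divr_ge0//.
    apply: rnorm_geom_ge => //; have := rnorm_ge0 ((z : R[i]) - w); nra.
have : component_mass (circle_disc w r) x \is a fin_num.
  rewrite ge0_fin_numE ?component_mass_ge0//.
  by apply: le_lt_trans (component_mass_le _ mD) _; rewrite ltry.
move=> /fineK <-; rewrite -EFinM !lee_fin; set I := fine _ => h.
have {}h : N%:R * I <= 4 * beta.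
  rewrite -(ler_pM2l NR0); move: h; lra.
rewrite -(ler_pM2l NR0).
nra.
Qed.

(** Such a spectral measure does not charge the null sets of arc length. *)
Lemma component_mass_null (beta : R) x (A : set (borelC R)) : 0 < beta ->
  (forall (c : nat -> R[i]) N, (forall n, rnorm (c n) = 1) ->
     rnorm (\sum_(n < N) c n *: iter n T x) ^+ 2 <= beta * N%:R) ->
  measurable A -> arc_length A = 0%E ->
  component_mass (A `&` [set z | rnorm (z : R[i]) = 1]) x = 0%E.
Proof.
move=> beta0 synth mA A0; apply/eqP; rewrite eq_le component_mass_ge0 andbT.
apply/lee_addgt0Pr => e e0; rewrite add0e.
pose e' := Num.min (1 / 2) (e / (16 * beta)).
have b16 : 0 < 16 * beta by rewrite mulr_gt0.
have e'0 : 0 < e' by rewrite lt_min divr_gt0//= divr_gt0.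
have [w [r [w1 r0 Aw rsum]]] := arc_null_cover e'0 A0.
have r12 i : r i <= 1 / 2.
  apply: (@le_trans _ _ e'); last by rewrite ge_min lexx.
  rewrite -lee_fin; apply: le_trans rsum.
  by apply: (nneseries_ge_term (u := fun n => (r n)%:E)) => n; rewrite lee_fin.
apply: (@le_trans _ _ (\sum_(i <oo) component_mass (circle_disc (w i) (r i)) x)%E).
  apply: integral_cover_le.
  - exact: measurable_component.
  - by move=> z; rewrite lee_fin sqr_ge0.
  - apply: measurableI => //.
    exact: measurable_unit_circle.
  - by move=> i; exact: measurable_circle_disc.
  - by move=> z [Az z1]; have [i zi] := Aw z Az z1; exists i.
apply: (@le_trans _ _ (\sum_(i <oo) (16 * beta)%:E * (r i)%:E)%E).
  apply: lee_nneseries => i *; first exact: component_mass_ge0.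
  by rewrite -EFinM; apply: component_mass_disc; rewrite ?r0 ?r12.
rewrite nneseriesZl; last by move=> i _; rewrite lee_fin.
apply: (@le_trans _ _ ((16 * beta)%:E * e'%:E)%E).
  by rewrite lee_pmul2l.
by rewrite -EFinM lee_fin -ler_pdivlMl// mulrC ge_min lexx orbT.
Qed.

End SpectralComponents.

(** * Support of the multiplicity measures *)

Section CircleSupport.
Variables (R : realType) (H : completeNormedModType R[i]).
Variable nu : multiplicity -> {finite_measure set (borelC R) -> \bar R}.
Variables (T : H -> H) (U : H -> families R).
Hypothesis U_l2 : forall x, l2sum nu (U x).
Hypothesis U_iso : forall x, l2sum_normsq nu (U x) = (rnorm x ^+ 2)%:E.
Hypothesis U_surj : forall F, l2sum nu F -> exists x, l2sum_eq nu (U x) F.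
Hypothesis U_T : forall x, l2sum_eq nu (U (T x)) (mul_z (U x)).
Variables (j : multiplicity) (k : nat).
Hypothesis jk : copies j k.

Lemma l2sum_normsq_single (F : families R) :
  (forall j' k', copies j' k' -> measurable_fun [set: borelC R] (F j' k')) ->
  (forall j' k', copies j' k' -> (j', k') <> (j, k) ->
    F j' k' = (fun=> 0 : R[i]) %[ae nu j']) ->
  l2sum_normsq nu F = (\int[nu j]_z (rnorm (F j k z : R[i]) ^+ 2)%:E)%E.
Proof.
move=> mF F0; rewrite /l2sum_normsq.
pose g (i : multiplicity * nat) :=
  (\int[nu i.1]_z (rnorm (F i.1 i.2 z : R[i]) ^+ 2)%:E)%E.
have g0 i : (0 <= g i)%E by apply: integral_ge0 => z _; rewrite lee_fin sqr_ge0.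
transitivity (\esum_(i in [set i : multiplicity * nat | copies i.1 i.2])
    if i \in [set (j, k)] then g i else 0)%E.
  apply: eq_esum => -[j' k'] /= jk'; case: ifPn => // /negP; rewrite inE /= => ne.
  rewrite /g/=; transitivity (\int[nu j']_z (cst 0 z : \bar R))%E.
    apply: ae_eq_integral => //.
      by apply: measurable_sqnorm; exact: mF.
    by apply: filterS (F0 _ _ jk' ne) => z /= -> // _; rewrite rnorm0 expr0n/=.
  by rewrite integral_cst ?mul0e.
rewrite -esum_mkcondr.
have -> : [set i : multiplicity * nat | copies i.1 i.2] `&` [set (j, k)] =
    [set (j, k)] by apply/seteqP; split => [i []|i ->].
by rewrite esum_set1.
Qed.

(** The indicator function of [B] in the [k]-th copy of [L^2(nu j)], and zero in
    every other summand. *)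
Definition indicator_family (B : set (borelC R)) : families R :=
  fun j' k' z => if (j' == j) && (k' == k) && (z \in B) then 1 : R[i] else 0.

Lemma measurable_indicator_family B j' k' : measurable B ->
  measurable_fun [set: borelC R] (indicator_family B j' k').
Proof.
move=> mB; apply: measurable_fun_ifT => //.
have [_|_] := boolP ((j' == j) && (k' == k)); last exact: measurable_cst.
apply: (@measurable_fun_bool _ _ _ _ true).
rewrite setTI; move: mB; congr measurable.
by apply/seteqP; split => z /= => [/mem_set|/set_mem].
Qed.

(** A vector represented by [indicator_family B]: its norm and the norm of its
    image under [T] are computed in that single summand. *)
Lemma indicator_vector B : measurable B ->
  exists x, [/\ U x j k = indicator_family B j k %[ae nu j],
    (\int[nu j]_z (rnorm (U x j k z : R[i]) ^+ 2)%:E = (rnorm x ^+ 2)%:E)%E &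
    (\int[nu j]_z (rnorm (U (T x) j k z : R[i]) ^+ 2)%:E =
      (rnorm (T x) ^+ 2)%:E)%E].
Proof.
move=> mB.
have mI j' k' : measurable_fun setT (indicator_family B j' k').
  exact: measurable_indicator_family.
have I0 j' k' : (j', k') <> (j, k) -> indicator_family B j' k' = (fun=> 0 : R[i]).
  move=> ne; apply/funext => z; rewrite /indicator_family; case: ifP => //.
  by move=> /andP[/andP[/eqP e1 /eqP e2] _]; rewrite e1 e2 in ne.
have [|x xI] := U_surj (F := indicator_family B).
  split=> [j' k' _|]; first exact: mI.
  rewrite l2sum_normsq_single//; last first.
    by move=> j' k' _ ne; rewrite I0//; exact: aeW.
  apply: (@le_lt_trans _ _ (\int[nu j]_z (cst 1 z : \bar R))%E).
    apply: ge0_le_integral => //.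
    - by move=> z _; rewrite lee_fin sqr_ge0.
    - exact: measurable_sqnorm.
    - move=> z _; rewrite lee_fin /indicator_family.
      by case: ifP => _; rewrite ?rnorm1 ?rnorm0 ?expr1n ?expr0n.
  by rewrite integral_cst// mul1e ltey_eq fin_num_measure.
exists x; split.
- exact: xI.
- rewrite -U_iso l2sum_normsq_single// => [j' k'|j' k' jk' ne].
    by have [+ _] := U_l2 x; apply.
  by have := xI j' k' jk'; rewrite I0.
- rewrite -U_iso l2sum_normsq_single// => [j' k'|j' k' jk' ne].
    by have [+ _] := U_l2 (T x); apply.
  have := xI j' k' jk'; rewrite I0// => x0.
  apply: filterS2 x0 (U_T x jk') => z /= e -> // _.
  by rewrite /mul_z e// mulr0.
Qed.

Hypothesis T_iso : forall x, rnorm (T x) = rnorm x.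

(** The isometry of [T] on the vector represented by the indicator of [B]. *)
Lemma integral_sqnorm_mul_z B : measurable B ->
  (\int[nu j]_(z in B) (rnorm (z : R[i]) ^+ 2)%:E = \int[nu j]_(z in B) 1)%E.
Proof.
move=> mB; have [x [xB nx nTx]] := indicator_vector mB.
rewrite T_iso -nx in nTx.
have mUv v : measurable_fun setT (fun z => (rnorm (U v j k z : R[i]) ^+ 2)%:E).
  by apply: measurable_sqnorm; have [+ _] := U_l2 v; apply.
have mz : measurable_fun B (fun z : borelC R => (rnorm (z : R[i]) ^+ 2)%:E).
  exact: (@measurable_sqnorm _ id).
rewrite integral_mkcond [RHS]integral_mkcond.
transitivity (\int[nu j]_z (rnorm (U (T x) j k z : R[i]) ^+ 2)%:E)%E.
  apply: ae_eq_integral => //; first exact: (measurable_restrictT _ mB).1.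
  apply: filterS2 xB (U_T x jk) => z /= e -> // _.
  rewrite /mul_z e// /indicator_family !eqxx/= patchE.
  by case: ifPn => _; rewrite ?mulr1// mulr0 rnorm0 expr0n/=.
rewrite nTx; apply: ae_eq_integral => //.
  by apply: (measurable_restrictT _ mB).1; exact: measurable_cst.
apply: filterS xB => z /= -> // _.
rewrite /indicator_family !eqxx/= patchE.
by case: ifPn => _; rewrite ?rnorm1 ?expr1n// rnorm0 expr0n/=.
Qed.

(** Two finite integrals can agree while one integrand is strictly below the
    other only over a null set. *)
Lemma integral_lt_null (B : set (borelC R)) (f g : borelC R -> R) :
  measurable B -> measurable_fun B f -> measurable_fun B g ->
  (forall z, 0 <= f z) -> (forall z, B z -> f z < g z) ->
  (\int[nu j]_(z in B) (f z)%:E < +oo)%E ->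
  (\int[nu j]_(z in B) (f z)%:E = \int[nu j]_(z in B) (g z)%:E)%E ->
  nu j B = 0%E.
Proof.
move=> mB mf mg f0 fg foo fgE.
have mgf : measurable_fun B (fun z => (g z - f z)%:E).
  by apply/measurable_EFinP; exact: measurable_funB.
have gf0 z : B z -> (0 <= (g z - f z)%:E)%E.
  by move=> Bz; rewrite lee_fin subr_ge0 ltW// fg.
have e : (\int[nu j]_(z in B) (g z)%:E =
    \int[nu j]_(z in B) (f z)%:E + \int[nu j]_(z in B) (g z - f z)%:E)%E.
  rewrite -ge0_integralD//.
  - by apply: eq_integral => z _; rewrite -EFinD subrKC.
  - by move=> z _; rewrite lee_fin.
  - exact/measurable_EFinP.
have i0 : (\int[nu j]_(z in B) `|(g z - f z)%:E| = 0)%E.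
  transitivity (\int[nu j]_(z in B) (g z - f z)%:E)%E.
    by apply: eq_integral => z /set_mem Bz; rewrite gee0_abs// gf0.
  have ffin : (\int[nu j]_(z in B) (f z)%:E)%E \is a fin_num.
    by rewrite ge0_fin_numE// integral_ge0// => z _; rewrite lee_fin.
  by rewrite -[LHS](addeK _ ffin) [X in (X - _)%E]addeC -e -fgE subee.
have [N [mN N0 BN]] := (ae_eq_integral_abs (nu j) mB mgf).1 i0.
apply: (subset_measure0 mB mN _ N0) => z Bz; apply: BN => /= h.
have := h Bz => -[] /eqP; rewrite subr_eq0 gt_eqF//; exact: fg.
Qed.

(** The integrals of [|z|^2] and of [1] agree over [{|z| < 1}] and over
    [{|z| > 1}], which are therefore null. *)
Lemma off_circle_null : nu j [set z | rnorm (z : R[i]) <> 1] = 0%E.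
Proof.
have mz D : measurable_fun D (fun z : borelC R => rnorm (z : R[i])).
  by apply: (@measurable_funS _ _ _ _ setT) => //; exact: measurable_rnorm.
have mD I : measurable [set z : borelC R | rnorm (z : R[i]) \in (I : interval R)].
  by have := @measurable_rnorm R measurableT _ (measurable_itv I); rewrite setTI.
pose L := [set z : borelC R | rnorm (z : R[i]) \in `]-oo, 1[].
pose G := [set z : borelC R | rnorm (z : R[i]) \in `]1, +oo[].
have mL : measurable L := mD _; have mG : measurable G := mD _.
have oneoo B : measurable B -> (\int[nu j]_(z in B) 1 < +oo)%E.
  by move=> mB; rewrite integral_cst// mul1e ltey_eq fin_num_measure.
have L0 : nu j L = 0%E.
  have e := integral_sqnorm_mul_z mL.
  apply: (integral_lt_null (g := cst 1) mL _ _ _ _ _ e) => //.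
  - by apply: measurable_funX.
  - by move=> z; rewrite sqr_ge0.
  - by move=> z; rewrite /L /= in_itv/= => z1; rewrite expr_lt1// rnorm_ge0.
  - by rewrite e oneoo.
have G0 : nu j G = 0%E.
  have e := integral_sqnorm_mul_z mG.
  apply: (integral_lt_null (f := cst 1) mG _ _ _ _ _ (esym e)) => //.
  - by apply: measurable_funX.
  - by move=> z; rewrite /G /= in_itv/= andbT => z1; rewrite expr_gt1// ?rnorm_ge0// ltW.
  - exact: oneoo.
have -> : [set z | rnorm (z : R[i]) <> 1] = L `|` G.
  apply/seteqP; split => z /=; rewrite /L /G /= !in_itv/= andbT.
    by move=> /eqP; rewrite neq_lt => /orP.
  by move=> /orP; rewrite -neq_lt => /eqP.
apply/eqP; rewrite -measure_le0.
have LG : (nu j (L `|` G) <= nu j L + nu j G)%E by exact: measureU2.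
by apply: le_trans LG _; rewrite L0 G0 adde0.
Qed.

End CircleSupport.

(** * Unitary representations and absolute continuity *)

Lemma infinite_order_expg_inj (Gamma : groupType) (a : Gamma) :
  infinite_order a -> injective (fun n : nat => (a ^+ n)%g).
Proof.
move=> aoo; suff le m n : (m <= n)%N -> (a ^+ m)%g = (a ^+ n)%g -> m = n.
  move=> m n e; have [mn|nm] := leqP m n; first exact: le.
  by apply/esym/le => //; exact: ltnW.
move=> mn; rewrite -(subnKC mn) expgnDr -[LHS]mulg1.
move=> /mulgI e; have [nm|nm] := posnP (n - m).
  by rewrite nm addn0.
by case: (aoo _ nm).
Qed.

Section Unitary.
Variables (R : realType) (H : completeNormedModType R[i]).
Variable dot : {dot H for Num.conj}.
Hypothesis hilbertH : hilbert_norm dot.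

Lemma unitary_rnorm (T : H -> H) x : unitary_op dot T -> rnorm (T x) = rnorm x.
Proof.
move=> [_ Tdot _]; have := Tdot x x; rewrite !(dot_rnorm hilbertH).
by move=> /complexI /eqP; rewrite eqrXn2 ?rnorm_ge0// => /eqP.
Qed.

Lemma iter_representation (Gamma : groupType) (pi : Gamma -> H -> H) a b n x :
  unitary_representation dot pi ->
  iter n (pi a) (pi b x) = pi (a ^+ n * b)%g x.
Proof.
move=> [_ _ piM]; elim: n => [|n ih]; first by rewrite expg0 mul1g.
by rewrite iterS ih expgS -mulgA [in RHS]piM.
Qed.

End Unitary.

Theorem theorem7p3 (R : realType)
    (H : completeNormedModType R[i]) (dot : {dot H for Num.conj})
    (hilbertH : hilbert_norm dot)
    (infH : infinite_dimensional H) (sepH : separable H)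
    (Gamma : groupType) (pi : Gamma -> H -> H)
    (pi_rep : unitary_representation dot pi)
    (G : set H)
    (completeG :
       complete_system [set pi gamma g | gamma in [set: Gamma] & g in G])
    (besselG : forall g : H, G g -> bessel dot (fun gamma : Gamma => pi gamma g))
    (gamma : Gamma) (gamma_oo : infinite_order gamma)
    (mu : {measure set (borelC R) -> \bar R})
    (mu_spec : scalar_spectral_measure (pi gamma) mu) :
  mu `<< @arc_length R.
Proof.
have [pi_unitary _ _] := pi_rep.
have [nu [_ _ [U [U_l2 U_lin U_iso U_surj U_T]] muE]] := mu_spec.
apply/null_content_dominatesP => A mA A0; rewrite muE// esum1// => j _.
(* Every multiplicity is at least one, so the copy of index zero of
   [L^2(nu j)] is always present. *)
have j0 : copies j 0%N by case: (j).
pose C : set (borelC R) := [set z | rnorm (z : R[i]) = 1].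
have mC : measurable C by exact: measurable_unit_circle.
have mAC : measurable (A `&` C) by exact: measurableI.
pose q := component_mass nu U j 0%N (A `&` C).
have q0 x : (0 <= q x)%E by exact: component_mass_ge0.
have q_zero : q 0 = 0%E.
  apply/eqP; rewrite eq_le q0 andbT.
  by apply: le_trans (component_mass_le U_l2 U_iso j0 _ mAC) _; rewrite rnorm0 expr0n.
have q_orbit a g : G g -> q (pi a g) = 0%E.
  move=> /besselG/(bessel_synthesis hilbertH)[beta beta0 synth].
  apply: (component_mass_null U_l2 U_lin U_iso U_T j0 beta0) => // c N c1.
  under eq_bigr do rewrite (iter_representation _ _ _ _ pi_rep).
  apply: (synth (fun n => gamma ^+ n * a)%g) => // m n /mulIg.
  exact: infinite_order_expg_inj.
have qD (a : R[i]) x y : q x = 0%E -> q y = 0%E -> q (a *: x + y) = 0%E.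
  move=> x0 y0; apply/eqP; rewrite eq_le q0 andbT.
  apply: le_trans (component_massD U_l2 U_lin j0 _ _ _ mAC) _.
  by rewrite -/(q x) -/(q y) x0 y0 !mule0 adde0.
have q_span x : lin_span [set pi a g | a in [set: Gamma] & g in G] x -> q x = 0%E.
  move=> [n [c [u [uS ->]]]].
  apply: (big_ind (fun v => q v = 0%E)).
  - exact: q_zero.
  - by move=> x1 x2 x10 x20; rewrite -[x1]scale1r; exact: qD.
  - move=> i _; have [a _ [g Gg <-]] := uS i.
    rewrite -[X in q X]addr0; apply: qD; [exact: q_orbit|exact: q_zero].
have q_all x : q x = 0%E.
  apply/eqP; rewrite eq_le q0 andbT; apply/lee_addgt0Pr => e e0; rewrite add0e.
  have d0 : 0 < Num.sqrt (e / 2) by rewrite sqrtr_gt0 divr_gt0.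
  have : closure (lin_span [set pi a g | a in [set: Gamma] & g in G]) x.
    by rewrite completeG.
  move=> /(_ (ball x ((Num.sqrt (e / 2))%:C)%C))[|s [sS xs]].
    by apply: nbhsx_ballx; rewrite ltcR.
  move: xs; rewrite -ball_normE /= normE_rnorm ltcR => xs.
  rewrite -(subrK s x) -[x - s]scale1r.
  apply: le_trans (component_massD U_l2 U_lin j0 _ _ _ mAC) _.
  rewrite -/(q s) (q_span _ sS) mule0 adde0 rnorm1 expr1n mulr1.
  apply: (@le_trans _ _ (2%:E * (rnorm (x - s) ^+ 2)%:E)%E).
    rewrite lee_pmul2l//; apply: (component_mass_le U_l2 U_iso j0 _ mAC).
  have : rnorm (x - s) ^+ 2 <= e / 2.
    rewrite -[leRHS]sqr_sqrtr; last by rewrite divr_ge0// ltW.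
    by rewrite lerXn2r ?nnegrE ?rnorm_ge0 ?sqrtr_ge0// ltW.
  by rewrite -EFinM lee_fin; lra.
(* For the vector [x] represented by the indicator function of [A `&` C], the
   mass [q x] is [nu j (A `&` C)]. *)
have AC0 : nu j (A `&` C) = 0%E.
  have [x [xA _ _]] := indicator_vector U_l2 U_iso U_surj U_T j0 mAC.
  rewrite -(q_all x) /q /component_mass -[LHS]mul1e -integral_cst//.
  apply: ae_eq_integral => //; first exact: measurable_component.
  apply: filterS xA => z /= -> // ACz; rewrite /indicator_family !eqxx/=.
  by rewrite mem_set// rnorm1 expr1n.
have C0 : nu j (~` C) = 0%E.
  apply: (off_circle_null U_l2 U_iso U_surj U_T j0) => x.
  exact: (unitary_rnorm hilbertH).
have Asub : A `<=` (A `&` C) `|` ~` C.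
  by move=> z Az; have [Cz|nCz] := pselect (C z); [left|right].
apply: (subset_measure0 mA _ Asub); first by apply: measurableU => //; exact: measurableC.
have le0 : (nu j ((A `&` C) `|` ~` C) <= nu j (A `&` C) + nu j (~` C))%E.
  by apply: measureU2 => //; exact: measurableC.
by apply/eqP; rewrite -measure_le0; apply: le_trans le0 _; rewrite AC0 C0 adde0.
Qed.
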